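(* Let $N$ be even, let $f_h:\mathbb{R}^{N-1}\to\mathbb{R}$ satisfy the assumptions in the context with constants $\mu_h,L_h,M_h$, let $\mathbf{x}_{h,\star}$ be its minimizer, and let $\mathbf{P}\in\mathbb{R}^{(N-1)\times(N/2-1)}$ and $\mathbf{R}=\frac12\mathbf{P}^T$ be the one-dimensional linear interpolation and restriction operators defined in the context. If $\mathbf{x}_{h,k}\in\mathbb{R}^{N-1}$ and the coarse correction step $\hat{\mathbf{d}}_{h,k}=-\mathbf{P}[\mathbf{R}\nabla^2 f_h(\mathbf{x}_{h,k})\mathbf{P}]^{-1}\mathbf{R}\nabla f_h(\mathbf{x}_{h,k})$ is taken with stepsize $\alpha_{h,k}=1$, i.e. $\mathbf{x}_{h,k+1}=\mathbf{x}_{h,k}+\hat{\mathbf{d}}_{h,k}$, then $$\Vert\mathbf{x}_{h,k+1}-\mathbf{x}_{h,\star}\Vert\le\sqrt{\frac{L_h}{\mu_h}}\ \min_{w\in\mathcal{F}^{N-1}_{\mathbf{x}_{h,k}-\mathbf{x}_{h,\star}}}\ \max_{y\in[0,1]}|w''(y)|\ \frac{3}{4N^{3/2}}+\frac{M_h\omega^2\xi^2}{2\mu_h}\Vert\mathbf{x}_{h,k}-\mathbf{x}_{h,\star}\Vert^2$$ $$\le\frac{9}{4N^{3/2}}\sqrt{\frac{L_h}{\mu_h}}\,\Vert\mathbf{A}(\mathbf{x}_{h,k}-\mathbf{x}_{h,\star})\Vert+\frac{M_h\omega^2\xi^2}{2\mu_h}\Vert\mathbf{x}_{h,k}-\mathbf{x}_{h,\star}\Vert^2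 .$$
   Context: $\Vert\cdot\Vert$ is the Euclidean norm for vectors and the induced (spectral) norm for matrices. $N\ge 4$ is an even integer (so that the coarse dimension $N/2-1$ is at least $1$). Assumptions on $f_h$: $f_h:\mathbb{R}^{N-1}\to\mathbb{R}$ is twice differentiable and there are constants $\mu_h,L_h,M_h>0$ with $\mu_h\mathbf{I}\preccurlyeq\nabla^2 f_h(\mathbf{x})\preccurlyeq L_h\mathbf{I}$ and $\Vert\nabla^2 f_h(\mathbf{x})-\nabla^2 f_h(\mathbf{y})\Vert\le M_h\Vert\mathbf{x}-\mathbf{y}\Vert$ for all $\mathbf{x},\mathbf{y}\in\mathbb{R}^{N-1}$. Operators: $\mathbf{P}\in\mathbb{R}^{(N-1)\times(N/2-1)}$ is the matrix whose $j$-th column ($1\le j\le N/2-1$) has entries $\frac12,1,\frac12$ in rows $2j-1,2j,2j+1$ and zeros elsewhere; $\mathbf{R}=\frac12\mathbf{P}^T\in\mathbb{R}^{(N/2-1)\times(N-1)}$. $\omega=\max\{\Vert\mathbf{P}\Vert,\Vert\mathbf{R}\Vert\}$, $\mathbf{P}^+=(\mathbf{R}\mathbf{P})^{-1}\mathbf{R}$ is the pseudoinverse of $\mathbf{P}$ and $\xi=\Vert\mathbf{P}^+\Vert$. For $\mathbf{r}\in\mathbb{R}^{N-1}$, $\mathcal{F}^{N-1}_{\mathbf{r}}$ is the set of twice differentiable functions $w$ on $[0,1]$ with $w(0)=w(1)=0$ and $w(i/N)=(\mathbf{r})_i$ for $i=1,\dots,N-1$. The min over $w$ and max over $y$ are read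 as infimum and supremum (with value in $[0,+\infty]$) if not attained. $\mathbf{A}\in\mathbb{R}^{(N-1)\times(N-1)}$ is $N^2$ times the tridiagonal matrix with $2$ on the diagonal and $-1$ on the first sub- and superdiagonals. *)

(* Defs.v *)
From HB Require Import structures.
From mathcomp Require Import all_boot all_order all_algebra.
From mathcomp Require Import all_classical all_reals all_analysis.
Import Order.TTheory GRing.Theory Num.Theory.
Import numFieldNormedType.Exports.

Set Implicit Arguments.
Unset Strict Implicit.
Unset Printing Implicit Defensive.

Local Open Scope classical_set_scope.
Local Open Scope ring_scope.

(* The library norm [`|v|] on matrices is the max norm, so the Euclidean and
   spectral norms are defined here. *)
Definition enorm (R : realType) (n : nat) (v : 'cV[R]_n) : R :=
  Num.sqrt (\sum_(i < n) v i 0 ^+ 2).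

Definition opnorm (R : realType) (m n : nat) (A : 'M[R]_(m, n)) : R :=
  sup [set enorm (A *m v) | v in [set v : 'cV[R]_n | enorm v <= 1]].

Definition psdmx (R : realType) (n : nat) (A : 'M[R]_n) : Prop :=
  A^T = A /\ forall v : 'cV[R]_n, 0 <= (v^T *m A *m v) 0 0.

Definition loewner_le (R : realType) (n : nat) (A B : 'M[R]_n) : Prop :=
  psdmx (B - A).

Definition gradient (R : realType) (n : nat) (f : 'cV[R]_n -> R)
    (x : 'cV[R]_n) : 'cV[R]_n :=
  \col_(i < n) 'D_(delta_mx i 0) f x.

Definition hessian (R : realType) (n : nat) (f : 'cV[R]_n -> R)
    (x : 'cV[R]_n) : 'M[R]_n :=
  \matrix_(i < n, j < n) 'D_(delta_mx j 0) (fun z => gradient f z i 0) x.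

(* Frechet differentiability of [f] and of its gradient; the library topology
   on ['cV[R]_n] is the Euclidean one since all norms are equivalent. *)
Definition twice_differentiable (R : realType) (n : nat)
    (f : 'cV[R]_n -> R) : Prop :=
  (forall x, differentiable f x) /\ (forall x, differentiable (gradient f) x).

(* Row [i] and column [j] are 0-based: the entries 1/2, 1, 1/2 of column
   [j.+1] in rows [2 * j.+1 - 1], [2 * j.+1], [2 * j.+1 + 1] are found at the
   0-based rows [2 * j], [2 * j + 1], [2 * j + 2]. *)
Definition interpolation (R : realType) (N : nat) :
    'M[R]_(N.-1, N./2.-1) :=
  \matrix_(i, j)
    if (i == (2 * j).+1 :> nat) then 1
    else if (i == 2 * j :> nat)%N || (i == (2 * j).+2 :> nat) then 2^-1
    else 0.

Definition restriction (R : realType) (N : nat) : 'M[R]_(N./2.-1, N.-1) :=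
  2^-1 *: (interpolation R N)^T.

Definition omega (R : realType) (N : nat) : R :=
  Num.max (opnorm (interpolation R N)) (opnorm (restriction R N)).

Definition interpolation_pinv (R : realType) (N : nat) :
    'M[R]_(N./2.-1, N.-1) :=
  invmx (restriction R N *m interpolation R N) *m restriction R N.

Definition xi (R : realType) (N : nat) : R := opnorm (interpolation_pinv R N).

Definition coarse_step (R : realType) (N : nat) (f : 'cV[R]_N.-1 -> R)
    (x : 'cV[R]_N.-1) : 'cV[R]_N.-1 :=
  - (interpolation R N
     *m invmx (restriction R N *m hessian f x *m interpolation R N)
     *m restriction R N *m gradient f x).

Definition laplacian (R : realType) (N : nat) : 'M[R]_N.-1 :=
  N%:R ^+ 2 *:
  \matrix_(i, j)
    if i == j then 2
    else if (i.+1 == j :> nat) || (j.+1 == i :> nat) then -1 else 0.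

(* Functions on [0, 1] are represented by total functions on [R] of which only
   the values on [0, 1] are used. The limit of the difference quotient is
   taken inside [0, 1], hence is one-sided at 0 and at 1. *)
Definition derivable01 (R : realType) (w : R -> R) : Prop :=
  forall y : R, y \in `[0, 1] ->
    cvg ((w z - w y) / (z - y) @[z --> within `[0, 1] y^']).

Definition derive01 (R : realType) (w : R -> R) (y : R) : R :=
  lim ((w z - w y) / (z - y) @[z --> within `[0, 1] y^']).

Definition interpolants (R : realType) (N : nat) (r : 'cV[R]_N.-1) :
    set (R -> R) :=
  [set w | [/\ derivable01 w, derivable01 (derive01 w), w 0 = 0, w 1 = 0 &
    forall i : 'I_N.-1, w (i.+1%:R / N%:R) = r i 0]].

Definition min_max_curvature (R : realType) (N : nat) (r : 'cV[R]_N.-1) :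
    \bar R :=
  ereal_inf [set
    ereal_sup [set `|derive01 (derive01 w) y|%:E | y in `[0, 1]]
    | w in interpolants r].

(* Main.v *)
Require Import Defs.
From HB Require Import structures.
From mathcomp Require Import all_boot all_order all_algebra.
From mathcomp Require Import all_classical all_reals all_analysis.
From mathcomp Require Import zify ring lra.
Import Order.TTheory GRing.Theory Num.Theory.
Import numFieldNormedType.Exports.
Local Open Scope ring_scope.

(* Write [e = xk - xstar], [H] for the hessian and [g] for the gradient at [xk],
   and [G = P (R H P)^-1 R]. Then [xk1 - xstar = (e - G H e) + G (H e - g)].
   The first term is [e] minus its [H]-orthogonal projection onto the range of
   [P], so it is at most [sqrt (L / mu) * |e - P v|] for every [v]; when [v]
   samples [e] at the even nodes, [e - P v] consists of halved second differences
   of an interpolant [w] at the odd nodes, each of size [O(max |w''| / N^2)]. The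
   crude factor 2 lost by applying the mean value theorem twice, instead of
   Taylor's formula, is absorbed by the constant 3/4. In the second term
   [|G| <= 1 / mu], [|H e - g| <= M / 2 * |e|^2], and [omega * xi >= 1] because
   [P^+ P = 1]. For the second inequality an explicit interpolant with
   [|w''| <= 3 |A e|] is obtained from the piecewise linear one by rounding each
   corner locally. *)

Set Implicit Arguments.
Unset Strict Implicit.

(** * Euclidean and spectral norms *)

Lemma sqr_enorm (R : realType) (n : nat) (v : 'cV[R]_n) :
  enorm v ^+ 2 = (v^T *m v) 0 0.
Proof.
rewrite /enorm sqr_sqrtr; last by apply: sumr_ge0 => i _; rewrite sqr_ge0.
by rewrite mxE; apply: eq_bigr => i _; rewrite mxE expr2.
Qed.

Lemma enorm_ge0 (R : realType) (n : nat) (v : 'cV[R]_n) : 0 <= enorm v.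
Proof. exact: sqrtr_ge0. Qed.

Lemma enorm_eq0 (R : realType) (n : nat) (v : 'cV[R]_n) :
  (enorm v == 0) = (v == 0).
Proof.
apply/eqP/eqP => [v0|->]; last first.
  by rewrite /enorm big1 ?sqrtr0// => i _; rewrite mxE expr0n.
have s0 : \sum_(i < n) v i 0 ^+ 2 = 0.
  move: (sqr_enorm v); rewrite v0 expr0n /= mxE => h; rewrite [RHS]h.
  by apply: eq_bigr => i _; rewrite mxE expr2.
apply/colP => i; rewrite mxE; apply/eqP; rewrite -sqrf_eq0.
move/eqP: s0; rewrite psumr_eq0; last by move=> j _; rewrite sqr_ge0.
by move/allP/(_ i (mem_index_enum _)).
Qed.

Lemma enorm0 (R : realType) (n : nat) : enorm (0 : 'cV[R]_n) = 0.
Proof. by apply/eqP; rewrite enorm_eq0. Qed.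

Lemma enormZ (R : realType) (n : nat) (a : R) (v : 'cV[R]_n) :
  enorm (a *: v) = `|a| * enorm v.
Proof.
rewrite /enorm -sqrtr_sqr -sqrtrM ?sqr_ge0// mulr_sumr; congr Num.sqrt.
by apply: eq_bigr => i _; rewrite mxE exprMn.
Qed.

Lemma coord_le_enorm (R : realType) (n : nat) (v : 'cV[R]_n) (i : 'I_n) :
  `|v i 0| <= enorm v.
Proof.
rewrite -sqrtr_sqr ler_wsqrtr// (bigD1 i)//= lerDl.
by apply: sumr_ge0 => j _; rewrite sqr_ge0.
Qed.

Lemma sqr_enorm_lin (R : realType) (n : nat) (a b : R) (u v : 'cV[R]_n) :
  enorm (a *: u + b *: v) ^+ 2 =
  a ^+ 2 * enorm u ^+ 2 + 2 * (a * b) * (u^T *m v) 0 0 + b ^+ 2 * enorm v ^+ 2.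
Proof.
rewrite !sqr_enorm !mxE !mulr_sumr -!big_split /=; apply: eq_bigr => i _.
by rewrite !mxE; ring.
Qed.

(** Cauchy-Schwarz: the square of [|v| u - |u| v] is nonnegative and expands to
    [2 |u| |v| (|u| |v| - u^T v)]. *)
Lemma dot_le_enorm (R : realType) (n : nat) (u v : 'cV[R]_n) :
  (u^T *m v) 0 0 <= enorm u * enorm v.
Proof.
have [u0|u0] := eqVneq (enorm u) 0.
  move/eqP: (u0); rewrite enorm_eq0 => /eqP ->.
  by rewrite trmx0 mul0mx mxE mulr_ge0 ?enorm_ge0.
have [v0|v0] := eqVneq (enorm v) 0.
  move/eqP: (v0); rewrite enorm_eq0 => /eqP ->.
  by rewrite mulmx0 mxE mulr_ge0 ?enorm_ge0.
have up : 0 < enorm u by rewrite lt_def u0 enorm_ge0.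
have vp : 0 < enorm v by rewrite lt_def v0 enorm_ge0.
have : 0 <= enorm (enorm v *: u + (- enorm u) *: v) ^+ 2 by rewrite sqr_ge0.
rewrite sqr_enorm_lin.
move: up vp; move: (enorm u) (enorm v) (_ 0 0) => a b c a0 b0 h.
have : 0 <= (2 * (a * b)) * (a * b - c).
  apply: le_trans h _; rewrite le_eqVlt; apply/orP; left; apply/eqP; ring.
by rewrite pmulr_rge0 ?subr_ge0// !mulr_gt0.
Qed.

Lemma enormD (R : realType) (n : nat) (u v : 'cV[R]_n) :
  enorm (u + v) <= enorm u + enorm v.
Proof.
rewrite -(ler_pXn2r (ltn0Sn 1)) ?nnegrE ?addr_ge0 ?enorm_ge0//.
rewrite -[X in enorm (X + _)]scale1r -[X in enorm (_ + X)]scale1r sqr_enorm_lin.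
by have := dot_le_enorm u v; nra.
Qed.

Lemma enormN (R : realType) (n : nat) (v : 'cV[R]_n) : enorm (- v) = enorm v.
Proof. by rewrite -scaleN1r enormZ normrN1 mul1r. Qed.

(** Cauchy-Schwarz on each row bounds [|A v|] over the unit ball by the Frobenius norm, so the [sup]
    in [opnorm] is a genuine least upper bound. *)
Lemma opnorm_has_sup (R : realType) (m n : nat) (A : 'M[R]_(m, n)) :
  has_sup [set enorm (A *m v) | v in [set v : 'cV[R]_n | enorm v <= 1]]%classic.
Proof.
split.
  by exists (enorm (A *m 0)), 0 => //=; rewrite enorm0.
exists (Num.sqrt (\sum_(i < m) enorm (row i A)^T ^+ 2)) => _ [v /= v1 <-].
apply: ler_wsqrtr; apply: ler_sum => i _.
have hc : `|(A *m v) i 0| <= enorm (row i A)^T * enorm v.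
  have rowE (w : 'cV[R]_n) : (A *m w) i 0 = ((row i A)^T^T *m w) 0 0.
    by rewrite trmxK !mxE; apply: eq_bigr => j _; rewrite !mxE.
  rewrite ler_norml -[- _ <= _]lerN2 opprK; apply/andP; split.
    rewrite -(enormN v); have -> : - (A *m v) i 0 = (A *m - v) i 0.
      by rewrite mulmxN !mxE.
    by rewrite rowE dot_le_enorm.
  by rewrite rowE dot_le_enorm.
rewrite -real_normK ?num_real// ler_pXn2r ?nnegrE ?enorm_ge0//.
by apply: le_trans hc _; rewrite ler_piMr ?enorm_ge0.
Qed.

Lemma opnorm_ge0 (R : realType) (m n : nat) (A : 'M[R]_(m, n)) : 0 <= opnorm A.
Proof.
have /ubP ub := sup_upper_bound (opnorm_has_sup A).
apply: le_trans (ub (enorm (A *m 0)) _); first exact: enorm_ge0.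
by exists 0 => //=; rewrite enorm0.
Qed.

Lemma enorm_mulmx_le (R : realType) (m n : nat) (A : 'M[R]_(m, n))
    (v : 'cV[R]_n) :
  enorm (A *m v) <= opnorm A * enorm v.
Proof.
have [v0|v0] := eqVneq v 0.
  by rewrite v0 mulmx0 !enorm0 mulr0.
have vp : 0 < enorm v by rewrite lt_def enorm_eq0 v0 enorm_ge0.
have /ubP ub := sup_upper_bound (opnorm_has_sup A).
have := ub (enorm (A *m ((enorm v)^-1 *: v))).
rewrite -scalemxAr enormZ ger0_norm ?invr_ge0 ?enorm_ge0//.
rewrite mulrC ler_pdivrMr//; apply.
exists ((enorm v)^-1 *: v); last first.
  by rewrite -scalemxAr enormZ ger0_norm ?invr_ge0 ?enorm_ge0// mulrC.
by rewrite /= enormZ ger0_norm ?invr_ge0 ?enorm_ge0// mulVf ?gt_eqF.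
Qed.

(** Apply [B *m A = 1] to a basis vector; [0 < m] ensures that there is one. *)
Lemma opnorm_left_inverse (R : realType) (m n : nat) (A : 'M[R]_(n, m))
    (B : 'M[R]_(m, n)) :
  (0 < m)%N -> B *m A = 1%:M -> 1 <= opnorm B * opnorm A.
Proof.
case: m A B => // m A B _ BA1; set v : 'cV[R]_m.+1 := delta_mx 0 0.
have v0 : v != 0.
  by apply/eqP => /colP/(_ 0); rewrite !mxE eqxx => /eqP; rewrite oner_eq0.
have vp : 0 < enorm v by rewrite lt_def enorm_eq0 v0 enorm_ge0.
rewrite -(ler_pM2r vp) mul1r -[X in enorm X <= _]mul1mx -BA1 -mulmxA.
apply: le_trans (enorm_mulmx_le _ _) _.
by rewrite -mulrA ler_wpM2l ?opnorm_ge0// enorm_mulmx_le.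
Qed.

(** * Galerkin projection onto the range of [P], where [c *: P^T] plays the restriction *)

Lemma galerkin_unitmx (R : realType) (m n : nat) (P : 'M[R]_(n, m))
    (H : 'M[R]_n) (mu c : R) :
  0 < mu -> c != 0 -> (forall v, mu * enorm v ^+ 2 <= (v^T *m H *m v) 0 0) ->
  (forall z : 'cV_m, P *m z = 0 -> z = 0) ->
  c *: P^T *m H *m P \in unitmx.
Proof.
move=> mu0 c0 Hge Pinj; rewrite unitmxE unitfE; apply/negP => /det0P[v v0].
rewrite -!scalemxAl -scalemxAr => /eqP; rewrite scaler_eq0 (negbTE c0) /= => /eqP vK.
suff : P *m v^T = 0 by move/Pinj/eqP; rewrite trmx_eq0 (negbTE v0).
(* With [u = P v^T], coercivity gives [mu |u|^2 <= u^T H u], and the right side vanishes because [v]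
   is in the left kernel. *)
apply/eqP; rewrite -enorm_eq0 -sqrf_eq0 eq_le sqr_ge0 andbT.
rewrite -(pmulr_rle0 _ mu0); apply: le_trans (Hge _) _.
have -> : (P *m v^T)^T *m H *m (P *m v^T) = v *m (P^T *m H *m P) *m v^T.
  by rewrite trmx_mul trmxK !mulmxA.
by rewrite vK mul0mx mxE.
Qed.

(** Galerkin orthogonality: with [K = c P^T H P], multiplying by [c P^T] turns [H P K^-1 c P^T r]
    into [K K^-1 c P^T r = c P^T r]. *)
Lemma galerkin_residual (R : realType) (m n : nat) (P : 'M[R]_(n, m))
    (H : 'M[R]_n) (c : R) (r : 'cV[R]_n) :
  c != 0 -> c *: P^T *m H *m P \in unitmx ->
  P^T *m (r - H *m (P *m invmx (c *: P^T *m H *m P) *m (c *: P^T) *m r)) = 0.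
Proof.
move=> c0 KU; apply: (scalerI c0); rewrite scaler0 scalemxAl mulmxBr.
apply/eqP; rewrite subr_eq0; apply/eqP.
set K := (X in invmx X) in KU *.
by rewrite !mulmxA -/K mulmxV // mul1mx.
Qed.

(** Orthogonality of the residual to [u = P z] gives [u^T H u = u^T r], hence
    [mu |u|^2 <= |u| |r|]. *)
Lemma galerkin_enorm_le (R : realType) (m n : nat) (P : 'M[R]_(n, m))
    (H : 'M[R]_n) (mu c : R) (r : 'cV[R]_n) :
  0 < mu -> c != 0 -> (forall v, mu * enorm v ^+ 2 <= (v^T *m H *m v) 0 0) ->
  c *: P^T *m H *m P \in unitmx ->
  enorm (P *m invmx (c *: P^T *m H *m P) *m (c *: P^T) *m r) <= enorm r / mu.
Proof.
move=> mu0 c0 Hge KU; have := galerkin_residual r c0 KU.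
rewrite -(mulmxA P) -(mulmxA P).
move: (_ *m r) => z res.
have uHu : ((P *m z)^T *m H *m (P *m z)) 0 0 = ((P *m z)^T *m r) 0 0.
  have : z^T *m (P^T *m (r - H *m (P *m z))) = 0 by rewrite res mulmx0.
  rewrite mulmxA -trmx_mul mulmxBr => /subr0_eq ->.
  by rewrite !mulmxA.
have [->|u0] := eqVneq (P *m z) 0.
  by rewrite enorm0 divr_ge0 ?enorm_ge0 ?ltW.
have up : 0 < enorm (P *m z) by rewrite lt_def enorm_eq0 u0 enorm_ge0.
rewrite ler_pdivlMr// -(ler_pM2l up).
apply: le_trans (dot_le_enorm _ _); rewrite -uHu; apply: le_trans (Hge _).
by rewrite le_eqVlt; apply/orP; left; apply/eqP; ring.
Qed.

(* [e - P K^-1 R H e] is [H]-orthogonal to the range of [P], hence of minimal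
   [H]-norm in [e + range P]. *)
Lemma galerkin_best (R : realType) (m n : nat) (P : 'M[R]_(n, m))
    (H : 'M[R]_n) (mu L c : R) (e : 'cV[R]_n) (v : 'cV[R]_m) :
  0 < mu -> 0 < L -> c != 0 -> H^T = H ->
  (forall v, mu * enorm v ^+ 2 <= (v^T *m H *m v) 0 0) ->
  (forall v, (v^T *m H *m v) 0 0 <= L * enorm v ^+ 2) ->
  c *: P^T *m H *m P \in unitmx ->
  enorm (e - P *m invmx (c *: P^T *m H *m P) *m (c *: P^T) *m (H *m e)) <=
  Num.sqrt (L / mu) * enorm (e - P *m v).
Proof.
move=> mu0 L0 c0 Hsym Hge Hle KU.
have := galerkin_residual (H *m e) c0 KU; rewrite -mulmxBr.
rewrite -(mulmxA P) -(mulmxA P); move: (_ *m (H *m e)) => z.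
set a := e - P *m z => orth.
have -> : e - P *m v = a + P *m (z - v) by rewrite mulmxBr addrA subrK.
set b := P *m (z - v).
have ba : b^T *m H *m a = 0.
  by rewrite trmx_mul -!mulmxA orth mulmx0.
clearbody a b.
have ab : a^T *m H *m b = 0.
  have -> : a^T *m H *m b = (b^T *m H *m a)^T.
    by rewrite !trmx_mul trmxK Hsym mulmxA.
  by rewrite ba trmx0.
(* Pythagoras in the [H]-inner product: [mu |a|^2 <= a^T H a <= (a + b)^T H (a + b) <= L |a +
   b|^2]. *)
have ineq : mu * enorm a ^+ 2 <= L * enorm (a + b) ^+ 2.
  apply: le_trans (Hge _) (le_trans _ (Hle _)).
  have -> : (a + b)^T = a^T + b^T by apply/matrixP => i j; rewrite !mxE.
  rewrite !mulmxDl !mulmxDr ab ba addr0 add0r [X in _ <= X]mxE lerDl.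
  by apply: le_trans (Hge _); rewrite mulr_ge0 ?sqr_ge0 ?ltW.
rewrite -(@ler_pXn2r _ 2)// ?nnegrE ?mulr_ge0 ?sqrtr_ge0 ?enorm_ge0//.
rewrite exprMn (@sqr_sqrtr _ (L / mu)); last by rewrite divr_ge0 ?ltW.
rewrite -(ler_pM2l mu0).
suff -> : mu * (L / mu * enorm (a + b) ^+ 2) = L * enorm (a + b) ^+ 2 by [].
by field; rewrite gt_eqF.
Qed.

(** * Linear interpolation at the nodes. The sequence [rho] lists the values at the nodes [0] to
    [N], and row [i] belongs to node [i.+1], so odd rows are the coarse nodes *)

Lemma mulmx_interpolation (R : realType) (N : nat) (rho : nat -> R) (i : 'I_N.-1) :
  ~~ odd N -> rho 0%N = 0 -> rho N = 0 ->
  (interpolation R N *m \col_j rho (2 * j).+2) i 0 =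
  if odd i then rho i.+1 else (rho i + rho i.+2) / 2.
Proof.
move=> Neven rho0 rhoN.
have pick (k : nat) : \sum_(j < N./2.-1) (if (j == k :> nat) then rho (2 * j).+2 else 0)
    = if (k < N./2.-1)%N then rho (2 * k).+2 else 0.
  rewrite -big_mkcond /=.
  rewrite (big_ord1_eq _ (fun j => rho (2 * j).+2)).
  by [].
have Nm : (2 * N./2)%N = N by rewrite mul2n even_halfK.
have im : (i < N.-1)%N by [].
rewrite mxE; case: ifPn => [io|ie].
  have iE : (2 * i./2).+1 = i by rewrite mul2n -[RHS]odd_double_half io.
  rewrite (eq_bigr (fun j : 'I_N./2.-1 => if (j == i./2 :> nat) then rho (2 * j).+2 else 0)).
    by rewrite pick ifT ?iE//; lia.
  move=> j _; rewrite !mxE.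
  case: eqP => h1; first by rewrite mul1r ifT//; apply/eqP; lia.
  rewrite (_ : (_ || _) = false) ?mul0r ?ifF//; first by apply/eqP; lia.
  by apply/negP => /orP[]/eqP; lia.
have iE : (2 * i./2)%N = i by rewrite mul2n even_halfK.
(* An even row meets column [i./2], carrying [rho i.+2], and the column before it, carrying [rho i].
   At either end of the grid one of them is missing, and its place is taken by [rho 0 = 0] or
   [rho N = 0]. *)
transitivity (\sum_(j < N./2.-1) (if (j == i./2 :> nat) then rho (2 * j).+2 else 0) / 2
  + \sum_(j < N./2.-1) (if (j.+1 == i./2 :> nat) then rho (2 * j).+2 else 0) / 2).
  rewrite -big_split; apply: eq_bigr => j _ /=; rewrite !mxE.
  rewrite ifF; last by apply/eqP; lia.
  have -> : (i == 2 * j :> nat)%N = (j == i./2 :> nat) by apply/eqP/eqP; lia.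
  have -> : (i == (2 * j).+2 :> nat)%N = (j.+1 == i./2 :> nat) by apply/eqP/eqP; lia.
  case: eqP => h1; case: eqP => h2 /=; try lia; ring.
rewrite -!mulr_suml pick -mulrDl addrC; congr ((_ + _) / 2).
  case Ei : i./2 => [|k].
    by rewrite big1// -iE Ei muln0 rho0.
  under eq_bigr do rewrite eqSS.
  rewrite pick ifT; first by rewrite -iE Ei mulnS.
  lia.
case: ifPn => h; first by rewrite iE.
by have -> : i.+2 = N by lia.
Qed.

(** Row [2 * j + 1] of [P] has a single nonzero entry, a [1] in column [j], so [z] can be read off
    from [P z]. *)
Lemma interpolation_inj (R : realType) (N : nat) (z : 'cV[R]_N./2.-1) :
  ~~ odd N -> interpolation R N *m z = 0 -> z = 0.
Proof.
move=> Neven Pz; apply/colP => j; rewrite mxE.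
have Nm : (2 * N./2)%N = N by rewrite mul2n even_halfK.
have jl : ((2 * j).+1 < N.-1)%N by have := ltn_ord j; lia.
move/colP: Pz => /(_ (Ordinal jl)); rewrite !mxE (bigD1 j)//= big1 ?addr0.
  by rewrite !mxE eqxx mul1r.
move=> k kj; rewrite !mxE /=.
have kj' : k <> j :> nat by move/val_inj/eqP; rewrite (negbTE kj).
rewrite ifF; last by apply/eqP; lia.
rewrite (_ : (_ || _) = false) ?mul0r//.
by apply/negP => /orP[]/eqP; lia.
Qed.

Lemma sum_even_ord (n : nat) : (\sum_(i < n) ~~ odd i)%N = uphalf n.
Proof.
elim: n => [|n IH]; first by rewrite big_ord0.
by rewrite big_ord_recr /= IH; lia.
Qed.

(** The error vanishes at the coarse nodes. At each of the [N / 2] even rows it is minus half a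
    second difference, hence at most [b] in absolute value. *)
Lemma enorm_interpolation_error (R : realType) (N : nat) (rho : nat -> R) (b : R) :
  ~~ odd N -> rho 0%N = 0 -> rho N = 0 -> 0 <= b ->
  (forall i, (i.+2 <= N)%N -> `|rho i - 2 * rho i.+1 + rho i.+2| <= 2 * b) ->
  enorm (\col_(i < N.-1) rho i.+1 - interpolation R N *m \col_j rho (2 * j).+2) ^+ 2
  <= N%:R / 2 * b ^+ 2.
Proof.
move=> Neven rho0 rhoN b0 hb; rewrite sqr_sqrtr; last first.
  by apply: sumr_ge0 => i _; exact: sqr_ge0.
have -> : N%:R / 2 * b ^+ 2 = \sum_(i < N.-1) (~~ odd i)%:R * b ^+ 2.
  rewrite -mulr_suml -natr_sum sum_even_ord; congr (_ * _).
  have -> : uphalf N.-1 = N./2 by lia.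
  by rewrite -[N in LHS](even_halfK Neven) -mul2n natrM mulrAC divff ?mul1r ?pnatr_eq0.
apply: ler_sum => i _.
have -> : (\col_(i < N.-1) rho i.+1 - interpolation R N *m \col_j rho (2 * j).+2) i 0
    = rho i.+1 - (interpolation R N *m \col_j rho (2 * j).+2) i 0 by rewrite !mxE.
rewrite mulmx_interpolation//.
case: ifPn => io /=; first by rewrite subrr expr0n mul0r.
rewrite mul1r -real_normK ?num_real// ler_pXn2r ?nnegrE//.
have := hb i; have := ltn_ord i; move: (rho _) (rho _) (rho _) => x y z h.
move/(_ ltac:(lia)); rewrite !ler_norml; lra.
Qed.

(** * Derivatives along lines, first order optimality and the Newton residual *)

(** A quadratic remainder gives the derivative by pure algebra; this serves polynomials of degree at
    most two and also [t * |t|], which has a kink in its derivative. *)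
Lemma is_derive_quadratic (R : realType) (g : R -> R) (x l C : R) :
  (forall h, `|g (h + x) - g x - l * h| <= C * h ^+ 2) ->
  is_derive x (1 : R) g l.
Proof.
move=> hC.
have C0 : 0 <= C.
  by have := hC 1; rewrite expr1n !mulr1 => h; exact: le_trans (normr_ge0 _) h.
have L : ((fun h : R => h^-1 *: ((g \o shift x) (h *: (1:R)) - g x)) @ 0^' --> l)%classic.
  (* The [+ 1] keeps the radius meaningful when [C = 0]. *)
  apply/cvgrPdist_le => /= e e0; exists (e / (C + 1)).
    by rewrite /= divr_gt0// ltr_wpDl.
  move=> h /= hle h0; rewrite sub0r normrN in hle.
  have hp : 0 < `|h| by rewrite normr_gt0.
  rewrite -(ler_pM2r hp) -normrM.
  have -> : (l - h^-1 *: (g (h *: 1 + x) - g x)) * h = - (g (h + x) - g x - l * h).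
    by rewrite /GRing.scale /= mulr1; field.
  rewrite normrN; apply: le_trans (hC _) _.
  rewrite -[h ^+ 2]real_normK ?num_real// expr2 mulrA ler_wpM2r//.
  move: hle; rewrite ltr_pdivlMr ?ltr_wpDl// => hle.
  by apply: le_trans (ltW hle); rewrite mulrC ler_wpM2l// lerDl.
by split; [apply/cvg_ex; exists l|exact/cvg_lim].
Qed.

Lemma is_derive_line (R : realType) (n : nat) (F : 'cV[R]_n -> R)
    (x v : 'cV[R]_n) (t df : R) :
  is_derive (x + t *: v) v F df ->
  is_derive t 1 (fun s => F (x + s *: v)) df.
Proof.
move=> [dF <-].
have E :
    (fun h => h^-1 *: (((fun s => F (x + s *: v)) \o shift t) (h *: (1:R))
                       - F (x + t *: v)))
    = (fun h => h^-1 *: ((F \o shift (x + t *: v)) (h *: v) - F (x + t *: v))).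
  apply/funext => h /=; congr (_ *: (F _ - _)).
  by rewrite scalerDl /= [h *: 1]mulr1 addrCA.
by split; rewrite /derivable /derive E.
Qed.

(** Along each coordinate line the restriction of [f] has an interior minimum at [0] of []-1,
    1[]. *)
Lemma gradient_min (R : realType) (n : nat) (f : 'cV[R]_n -> R) (x : 'cV[R]_n) :
  (forall z, differentiable f z) -> (forall y, f x <= f y) -> gradient f x = 0.
Proof.
move=> df xmin; apply/colP => i; rewrite !mxE.
set v := delta_mx i 0.
have D (t : R) : is_derive t (1 : R) (fun s => f (x + s *: v)) ('D_v f (x + t *: v)).
  apply: is_derive_line; apply/derivableP; exact: diff_derivable.
have m0 : (0 : R) \in `]-1, 1[ by rewrite in_itv /= oppr_lt0 ltr01.
have := @derive1_at_min R (fun s => f (x + s *: v)) (-1) 1 0 _ _ m0 _.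
case.
- by lra.
- by move=> t _; case: (D t).
- by move=> t _; rewrite scale0r addr0.
move=> _; case: (D 0) => _ ->; by rewrite scale0r addr0.
Qed.

(** Expand [v] in the standard basis and use linearity of the differential. *)
Lemma derive_gradient_coord (R : realType) (n : nat) (f : 'cV[R]_n -> R)
    (x v : 'cV[R]_n) (i : 'I_n) :
  differentiable (gradient f) x ->
  is_derive x v (fun z => gradient f z i 0) ((hessian f x *m v) i 0).
Proof.
move=> dg.
have dgi : differentiable (fun z => gradient f z i 0) x.
  by apply: (differentiable_comp dg (differentiable_coord _ _ _)).
split; first exact: diff_derivable.
rewrite deriveE//.
have -> : v = \sum_(j < n) v j 0 *: delta_mx j 0.
  rewrite {1}[v]matrix_sum_delta; apply: eq_bigr => j _.
  by rewrite big_ord1.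
rewrite linear_sum mulmx_sumr summxE; apply: eq_bigr => j _.
rewrite linearZ -scalemxAr !mxE; congr (_ * _).
rewrite -deriveE// (bigD1 j)//= big1 ?addr0.
  by rewrite !mxE eqxx mulr1.
by move=> k kj; rewrite !mxE (negbTE kj) mulr0.
Qed.

Lemma is_derive_dot_gradient (R : realType) (n : nat) (f : 'cV[R]_n -> R)
    (x v u : 'cV[R]_n) (t : R) :
  differentiable (gradient f) (x + t *: v) ->
  is_derive t 1 (fun s => (u^T *m gradient f (x + s *: v)) 0 0)
    ((u^T *m hessian f (x + t *: v) *m v) 0 0).
Proof.
move=> dg.
have -> : (fun s => (u^T *m gradient f (x + s *: v)) 0 0) =
    \sum_(i < n) (u i 0 \*: (fun s => gradient f (x + s *: v) i 0)).
  apply/funext => s; rewrite mxE fct_sumE; apply: eq_bigr => i _.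
  by rewrite mxE.
rewrite -mulmxA mxE; apply: is_derive_sum => i.
rewrite mxE -[_ * _]/(u i 0 *: (_ : R)); apply: is_deriveZ.
apply: (@is_derive_line _ _ (fun z => gradient f z i 0)).
exact: derive_gradient_coord.
Qed.

Lemma dotB (R : realType) (n : nat) (u v w : 'cV[R]_n) :
  (u^T *m (v - w)) 0 0 = (u^T *m v) 0 0 - (u^T *m w) 0 0.
Proof. by rewrite mulmxBr mxE [X in _ + X]mxE. Qed.

(** Testing the residual [u] against itself reduces the claim to a scalar function on [[0, 1]] and
    avoids vector-valued integrals: [psi] is nonincreasing enough that [psi 1 <= psi 0], which reads
    [|u|^2 <= K / 2] with [K = M |u| |e|^2]. *)
Lemma newton_residual (R : realType) (n : nat) (f : 'cV[R]_n -> R) (M : R)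
    (x e : 'cV[R]_n) :
  0 < M -> (forall z, differentiable (gradient f) z) ->
  (forall z y, opnorm (hessian f z - hessian f y) <= M * enorm (z - y)) ->
  enorm (gradient f (x + e) - gradient f x - hessian f (x + e) *m e) <=
  M / 2 * enorm e ^+ 2.
Proof.
move=> M0 dg Hlip.
have [H HE] : exists H, H = hessian f (x + e) by exists (hessian f (x + e)).
rewrite -HE.
have [u uE] : exists u, u = gradient f (x + e) - gradient f x - H *m e.
  by exists (gradient f (x + e) - gradient f x - H *m e).
rewrite -uE.
have [u0|u0] := eqVneq u 0.
  by rewrite u0 enorm0 mulr_ge0 ?sqr_ge0// divr_ge0// ltW.
have up : 0 < enorm u by rewrite lt_def enorm_eq0 u0 enorm_ge0.
pose K := M * enorm u * enorm e ^+ 2.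
have K0 : 0 <= K by rewrite /K !mulr_ge0 ?enorm_ge0 ?exprn_ge0 ?enorm_ge0 ?(ltW M0).
pose a := (u^T *m H *m e) 0 0.
(* The subtracted quadratic has derivative [a + K (1 - s)], the upper bound that the Lipschitz
   condition gives for the derivative of the first term. *)
pose psi (s : R) := (u^T *m gradient f (x + s *: e)) 0 0 - (a * s + K * (s - s ^+ 2 / 2)).
pose dpsi (s : R) := (u^T *m hessian f (x + s *: e) *m e) 0 0 - (a + K * (1 - s)).
have D (s : R) : is_derive s 1 psi (dpsi s).
  apply: is_deriveB; first exact: is_derive_dot_gradient.
  apply: (@is_derive_quadratic _ _ _ _ (K / 2)) => h.
  set y := (X in `|X|).
  have -> : y = - (K / 2 * h ^+ 2) by rewrite /y; field.
  by rewrite normrN ger0_norm// mulr_ge0 ?sqr_ge0// divr_ge0.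
have Cpsi : {within `[0, 1], continuous psi}%classic.
  apply: derivable_within_continuous => s _; by case: (D s).
have [c c01] := MVT ltr01 (fun s _ => D s) Cpsi.
rewrite subr0 mulr1 => psiE.
(* The hessians at [x + c e] and [x + e] differ by at most [M (1 - c) |e|]. *)
have : dpsi c <= 0.
  rewrite /dpsi /a -subr_ge0 sub0r opprB.
  have := dot_le_enorm u ((hessian f (x + c *: e) - H) *m e).
  have := enorm_mulmx_le (hessian f (x + c *: e) - H) e.
  have := Hlip (x + c *: e) (x + e).
  have -> : x + c *: e - (x + e) = (c - 1) *: e.
    by rewrite opprD addrACA subrr add0r scalerBl scale1r.
  have c1 : c - 1 <= 0 by move: c01; rewrite in_itv /= => /andP[_ ?]; rewrite subr_le0 ltW.
  rewrite enormZ ler0_norm// -HE => h1 h2.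
  rewrite {1}mulmxBl dotB !mulmxA => h3.
  suff : enorm u * enorm ((hessian f (x + c *: e) - H) *m e) <= K * (1 - c) by lra.
  have -> : K * (1 - c) = enorm u * (M * (- (c - 1) * enorm e) * enorm e) by rewrite /K; ring.
  rewrite ler_pM2l//; apply: le_trans h2 _.
  by rewrite ler_wpM2r ?enorm_ge0.
rewrite -psiE /psi scale1r scale0r addr0.
have uu := sqr_enorm u.
have : (u^T *m u) 0 0 = (u^T *m gradient f (x + e)) 0 0
   - (u^T *m gradient f x) 0 0 - a.
  by rewrite [X in _ *m X]uE !dotB /a mulmxA.
rewrite -uu => E h.
have uK : enorm u ^+ 2 <= K / 2 by lra.
rewrite -(ler_pM2l up) -expr2; apply: le_trans uK _.
by rewrite le_eqVlt; apply/orP; left; apply/eqP; rewrite /K; ring.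
Qed.

(** * Derivatives taken inside [[0, 1]] and second differences *)

Section OneSidedDerivative.
Local Open Scope classical_set_scope.
Local Open Scope ring_scope.

(** Every point of [[0, 1]] is an accumulation point: step towards the farther endpoint by at most
    [1 / 2]. Limits along this filter are therefore unique. *)
Lemma within01_proper (R : realType) (y : R) :
  y \in `[0, 1] -> ProperFilter (within `[0, 1] y^').
Proof.
rewrite in_itv /= => /andP[y0 y1].
apply: Build_ProperFilter => -[e /= e0 he].
have [yh|yh] := leP y (1 / 2).
  pose d := Num.min (e / 2) (1 / 2).
  have d0 : 0 < d by rewrite lt_min; apply/andP; split; lra.
  have de : d <= e / 2 by rewrite ge_min lexx.
  have dh : d <= 1 / 2 by rewrite ge_min lexx orbT.
  apply: (he (y + d)) => /=.
  - by rewrite opprD addrA subrr add0r normrN gtr0_norm//; lra.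
  - by apply/eqP; lra.
  - by rewrite in_itv /=; apply/andP; split; lra.
pose d := Num.min (e / 2) (1 / 2).
have d0 : 0 < d by rewrite lt_min; apply/andP; split; lra.
have de : d <= e / 2 by rewrite ge_min lexx.
have dh : d <= 1 / 2 by rewrite ge_min lexx orbT.
apply: (he (y - d)) => /=.
- by rewrite opprB addrC subrK gtr0_norm//; lra.
- by apply/eqP; lra.
- by rewrite in_itv /=; apply/andP; split; lra.
Qed.

Lemma is_derive_quotient (R : realType) (g : R -> R) (y l : R) :
  is_derive y (1 : R) g l <-> (g z - g y) / (z - y) @[z --> y^'] --> l.
Proof.
have dq : (h^-1 *: ((g \o shift y) (h *: (1 : R)) - g y) @[h --> 0^'] --> l) <->
    ((g z - g y) / (z - y) @[z --> y^'] --> l).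
  split=> /cvgrPdist_le H; apply/cvgrPdist_le => e /H[d /= d0 hd]; exists d => // z /= zd zy.
  - have := hd (z - y); rewrite /= sub0r normrN distrC subr_eq0 => /(_ zd zy).
    by rewrite /GRing.scale /= mulr1 subrK mulrC.
  - have zd' : `|y - (z + y)| < d by rewrite distrC addrK -normrN -sub0r.
    have zy' : z + y != y by rewrite -subr_eq0 addrK.
    have := hd _ zd' zy'; rewrite addrK /GRing.scale /= mulr1.
    by rewrite (mulrC z^-1).
rewrite -dq; split=> [[+ <-]|L]; first by move=> D; exact: D.
by split; [apply/cvg_ex; exists l|exact/cvg_lim].
Qed.

Lemma cvg_within01 (R : realType) (g w : R -> R) (y l : R) :
  y \in `[0, 1] -> {in `[0, 1], g =1 w} -> is_derive y (1 : R) g l ->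
  (w z - w y) / (z - y) @[z --> within `[0, 1] y^'] --> l.
Proof.
move=> y01 gw /is_derive_quotient /cvgrPdist_le H; apply/cvgrPdist_le => e /H[d /= d0 hd].
exists d => // z /= zd zy z01.
by rewrite -(gw _ z01) -(gw _ y01); exact: hd.
Qed.

(** Agreement is asked on [[0, 1]] only, so that the lemma can be iterated: its second conclusion
    serves as first hypothesis for [derive01 w]. *)
Lemma derivable01_is_derive (R : realType) (g w l : R -> R) :
  {in `[0, 1], g =1 w} -> (forall y, is_derive y (1 : R) g (l y)) ->
  derivable01 w /\ {in `[0, 1], l =1 derive01 w}.
Proof.
move=> gw gl; have L y : y \in `[0, 1] -> _ := fun y01 => cvg_within01 y01 gw (gl y).
split=> y y01; first by apply/cvg_ex; exists (l y); exact: L.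
have := within01_proper y01 => PF.
by apply/esym/cvg_lim; [exact: Rhausdorff|exact: L].
Qed.

Lemma is_derive_derive01 (R : realType) (w : R -> R) (y : R) :
  derivable01 w -> y \in `]0, 1[%R -> is_derive y (1 : R) w (derive01 w y).
Proof.
rewrite in_itv /= => dw /andP[y0 y1].
have y01 : y \in `[0, 1] by rewrite in_itv /= !ltW.
apply/is_derive_quotient.
have /cvgrPdist_le H : (w z - w y) / (z - y) @[z --> within `[0, 1] y^'] --> derive01 w y.
  exact: dw.
apply/cvgrPdist_le => e /H[d /= d0 hd].
(* This radius keeps [z] inside [[0, 1]], where the one-sided limit applies. *)
exists (Num.min d (Num.min y (1 - y))) => /=.
  by rewrite !lt_min d0 y0 subr_gt0.
move=> z /=; rewrite !lt_min => /and3P[zd zy z1] zny.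
apply: hd => //=; rewrite in_itv /=; move: zy z1; rewrite !ltr_norml.
by move=> /andP[? ?] /andP[? ?]; apply/andP; split; lra.
Qed.

Lemma derivable01_continuous (R : realType) (w : R -> R) :
  derivable01 w -> {within `[0, 1], continuous w}.
Proof.
move=> dw; apply/subspace_continuousP => y y01.
have /cvgrPdist_le H : (w z - w y) / (z - y) @[z --> within `[0, 1] y^'] --> derive01 w y.
  exact: dw.
have [d /= d0 hd] := H 1 ltr01.
apply/cvgrPdist_le => e e0.
(* Near [y] the quotients stay within [1] of their limit, so [w] satisfies a Lipschitz bound at [y]
   with constant [C]. *)
pose C := `|derive01 w y| + 1.
have C0 : 0 < C by rewrite ltr_wpDl.
exists (Num.min d (e / C)); first by rewrite /= lt_min d0 divr_gt0.
move=> z /=; rewrite lt_min => /andP[zd ze] z01.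
have [->|zy] := eqVneq z y; first by rewrite subrr normr0 ltW.
have zyp : 0 < `|z - y| by rewrite normr_gt0 subr_eq0.
have hq : `|(w z - w y) / (z - y)| <= C.
  have h := hd z zd zy z01.
  rewrite -[X in `|X|](subrK (derive01 w y)) addrC /C.
  by apply: le_trans (ler_normD _ _) _; rewrite lerD2l distrC.
rewrite distrC -[w z - w y](@divfK _ (z - y)) ?subr_eq0// normrM.
apply: le_trans (ler_wpM2r (normr_ge0 _) hq) _.
by rewrite distrC mulrC -ler_pdivlMr// ltW.
Qed.

Lemma MVT01 (R : realType) (w : R -> R) (a b : R) :
  derivable01 w -> 0 <= a -> a < b -> b <= 1 ->
  exists2 c, a < c < b & w b - w a = derive01 w c * (b - a).
Proof.
move=> dw a0 ab b1.
have [c||c] := @MVT R w (derive01 w) a b ab.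
- rewrite in_itv /= => /andP[ac cb]; apply: is_derive_derive01 => //.
  by rewrite in_itv /=; apply/andP; split; lra.
- apply: continuous_subspaceW (derivable01_continuous dw) => x /=.
  by rewrite !in_itv /= => /andP[? ?]; apply/andP; split; lra.
- by rewrite in_itv /= => h ->; exists c.
Qed.

(** Mean values on the two halves give [h (w' b - w' a)], and a third one gives [h (b - a) w'' c]
    with [b - a <= 2 h]. *)
Lemma second_difference_le (R : realType) (w : R -> R) (y h W : R) :
  derivable01 w -> derivable01 (derive01 w) -> 0 < h -> 0 <= y -> y + 2 * h <= 1 ->
  (forall z, z \in `[0, 1] -> `|derive01 (derive01 w) z| <= W) ->
  `|w y - 2 * w (y + h) + w (y + 2 * h)| <= 2 * (h ^+ 2 * W).
Proof.
move=> dw ddw h0 y0 y1 hW.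
have [|||a /andP[a1 a2] wa] := @MVT01 R w y (y + h) dw; try lra.
have [|||b /andP[b1 b2] wb] := @MVT01 R w (y + h) (y + 2 * h) dw; try lra.
have [|||c /andP[c1 c2] wc] := @MVT01 R _ a b ddw; try lra.
have -> : w y - 2 * w (y + h) + w (y + 2 * h) =
    (derive01 (derive01 w) c * (b - a)) * h.
  by rewrite -wc mulrBl; lra.
rewrite !normrM (gtr0_norm h0) (gtr0_norm (_ : 0 < b - a)); last by lra.
have : `|derive01 (derive01 w) c| <= W.
  by apply: hW; rewrite in_itv /=; apply/andP; split; lra.
have := normr_ge0 (derive01 (derive01 w) c); move: `|_| => q q0 qW.
have -> : 2 * (h ^+ 2 * W) = W * (2 * h) * h by ring.
rewrite ler_pM2r//; apply: ler_pM => //; lra.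
Qed.
End OneSidedDerivative.

(** * A twice differentiable rounding of the corner function *)

Lemma is_derive_mulnorm (R : realType) (x : R) :
  is_derive x (1 : R) (fun t => t * `|t|) (2 * `|x|).
Proof.
apply: (@is_derive_quadratic _ _ _ _ 1) => h.
rewrite mul1r ler_norml; apply/andP.
have hh := sqr_ge0 h; have hhx := sqr_ge0 (h + x); have xx := sqr_ge0 x.
have [x0|x0] := ger0P x; have [hx|hx] := ger0P (h + x).
- by split; lra.
- have := mulr_ge0_le0 x0 (ltW hx); split; lra.
- have := mulr_le0_ge0 (ltW x0) hx; split; lra.
- by split; lra.
Qed.

Lemma is_derive_sqr_mulnorm (R : realType) (x : R) :
  is_derive x (1 : R) (fun t => t * (t * `|t|)) (3 * (x * `|x|)).
Proof.
have -> : 3 * (x * `|x|) = x *: (2 * `|x|) + (x * `|x|) *: 1.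
  by rewrite /GRing.scale /=; ring.
exact: (is_deriveM (is_derive_id _ _) (is_derive_mulnorm x)).
Qed.

Lemma is_derive_affine (R : realType) (g : R -> R) (a b x l : R) :
  is_derive (a * x + b) (1 : R) g l ->
  is_derive x (1 : R) (fun t => g (a * t + b)) (a * l).
Proof.
move=> dg; rewrite mulrC.
have da : is_derive x (1 : R) (fun t => a * t + b) a.
  apply: (@is_derive_quadratic _ _ _ _ 0) => h.
  by rewrite mul0r [X in `|X|](_ : _ = 0) ?normr0//; ring.
exact: (@is_derive1_comp _ g (fun t => a * t + b) x l a dg da).
Qed.

Lemma is_derive_lin2 (R : realType) (f g : R -> R) (a b x df dg : R) :
  is_derive x (1 : R) f df -> is_derive x (1 : R) g dg ->
  is_derive x (1 : R) (fun t => a * f t + b * g t) (a * df + b * dg).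
Proof. by move=> df' dg'; exact: (is_deriveD (is_deriveZ a df') (is_deriveZ b dg')). Qed.

Lemma is_derive_lin_sum (R : realType) (n : nat) (c : 'I_n -> R)
    (g : 'I_n -> R -> R) (x : R) (dg : 'I_n -> R) :
  (forall i, is_derive x (1 : R) (g i) (dg i)) ->
  is_derive x (1 : R) (fun t => \sum_(i < n) c i * g i t) (\sum_(i < n) c i * dg i).
Proof.
move=> H; have -> : (fun t => \sum_(i < n) c i * g i t) = \sum_(i < n) (c i \*: g i).
  by apply/funext => t; rewrite fct_sumE.
by apply: is_derive_sum => i; exact: is_deriveZ.
Qed.

(* The factors [1 *] make every sum an instance of [is_derive_lin2]. *)
Definition stencil (R : realType) (g : R -> R) (t : R) : R :=
  2 / 3 * (1 * g (1 * t + - 2^-1) + 1 * g (1 * t + 2^-1)) +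
  1 * (- (7 / 6) * g t + - 12^-1 * (1 * g (1 * t + - 1) + 1 * g (1 * t + 1))).

Lemma is_derive_stencil (R : realType) (g g' : R -> R) (x : R) :
  (forall t, is_derive t (1 : R) g (g' t)) ->
  is_derive x (1 : R) (stencil g) (stencil g' x).
Proof.
move=> H.
have Hs s : is_derive x (1 : R) (fun t => g (1 * t + s)) (g' (1 * x + s)).
  by rewrite -[X in is_derive _ _ _ X]mul1r; apply: is_derive_affine.
by do !(exact: H || exact: Hs || apply: is_derive_lin2).
Qed.

(* The corner [max t 0] rounded into a twice differentiable cubic spline with
   knots [0], [+-1/2], [+-1] that keeps its values at the integers; the weights of
   [stencil] are chosen for this and for [|corner''| <= 3 * hat]. *)
Definition corner (R : realType) (t : R) : R :=
  2^-1 * t + 1 * stencil (fun s => s * (s * `|s|)) t.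

Definition corner' (R : realType) (t : R) : R :=
  2^-1 * 1 + 1 * stencil (fun s => 3 * (s * `|s|)) t.

Definition corner'' (R : realType) (t : R) : R := stencil (fun s => 3 * (2 * `|s|)) t.

Lemma is_derive_corner (R : realType) (x : R) :
  is_derive x (1 : R) (@corner R) (corner' x).
Proof.
exact: (is_derive_lin2 2^-1 1 (is_derive_id x (1 : R))
  (is_derive_stencil x (@is_derive_sqr_mulnorm R))).
Qed.

Lemma is_derive_corner' (R : realType) (x : R) :
  is_derive x (1 : R) (@corner' R) (corner'' x).
Proof.
have D3 t : is_derive t (1 : R) (fun s => 3 * (s * `|s|)) (3 * (2 * `|t|)).
  exact: (is_deriveZ 3 (is_derive_mulnorm t)).
have := is_derive_lin2 2^-1 1 (is_derive_cst (1 : R) x (1 : R)) (is_derive_stencil x D3).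
by rewrite mulr0 add0r mul1r; exact.
Qed.

(** The stencil maps [t^3] to [t / 2], so [corner t = max t 0] once [|t| >= 1]; at [0] the
    contributions of the knots cancel. Truncated subtraction expresses the maximum. *)
Lemma corner_nat (R : realType) (k m : nat) :
  corner (k%:R - m%:R : R) = (k - m)%N%:R.
Proof.
have [km|mk|->] := ltngtP k m.
- have -> : (k - m = 0)%N by apply/eqP; rewrite subn_eq0 ltnW.
  have : (k.+1%:R : R) <= m%:R by rewrite ler_nat.
  rewrite -natr1; move: (k%:R) (m%:R) => a b ab.
  rewrite /corner /stencil !ler0_norm; [|lra..].
  by field.
- rewrite natrB ?(ltnW mk)//.
  have : (m.+1%:R : R) <= k%:R by rewrite ler_nat.
  rewrite -natr1; move: (k%:R) (m%:R) => a b ab.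
  rewrite /corner /stencil !ger0_norm; [|lra..].
  by field.
- rewrite subrr subnn /corner /stencil normr0 !mulr0 !add0r !normrN normr1.
  by rewrite ger0_norm ?invr_ge0//; field.
Qed.

(** The right side is three times the hat function supported on [[-1, 1]]. Both sides are even, and
    for [t >= 0] the function [corner''] is affine between the knots [1/2] and [1]. *)
Lemma corner''_le (R : realType) (t : R) :
  `|corner'' t| <= 3 / 2 * (`|t + 1| - 2 * `|t| + `|t - 1|).
Proof.
wlog t0 : t / 0 <= t.
  move=> H; have [/H//|t0] := lerP 0 t.
  have nB (a b : R) : `|- a - b| = `|a + b| by rewrite -opprD normrN.
  have nD (a b : R) : `|- a + b| = `|a - b| by rewrite -normrN opprD opprK.
  have cE : corner'' (- t) = corner'' t.
    by rewrite /corner'' /stencil !mul1r !(nB, nD, normrN) ?opprK; ring.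
  have t0' : 0 <= - t by rewrite oppr_ge0 ltW.
  have := H _ t0'; rewrite cE nB nD normrN; lra.
rewrite /corner'' /stencil !mul1r (ger0_norm t0).
rewrite (ger0_norm (_ : 0 <= t + 2^-1)); last lra.
rewrite (ger0_norm (_ : 0 <= t + 1)); last lra.
rewrite ler_norml; apply/andP.
by have [h1|h1] := ger0P (t - 2^-1); have [h2|h2] := ger0P (t - 1); split; lra.
Qed.

(** The summands are doubled hats; the sum telescopes to [T n - T 0], and [|T i| <= 1]. *)
Lemma sum_hat_le (R : realType) (n : nat) (x : R) :
  \sum_(i < n) (`|x - i%:R + 1| - 2 * `|x - i%:R| + `|x - i%:R - 1|) <= 2.
Proof.
pose T (i : nat) := `|x - i%:R| - `|x - i%:R + 1|.
rewrite (eq_bigr (fun i : 'I_n => T i.+1 - T i)); last first.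
  move=> i _; have e1 : x - (i%:R + 1) + 1 = x - i%:R by ring.
  have e2 : x - (i%:R + 1) = x - i%:R - 1 by ring.
  by rewrite /T -(natr1 i) e1 e2; ring.
rewrite -(big_mkord xpredT (fun i => T i.+1 - T i)) telescope_sumr// /T subr0.
have := ler_normB (x - n%:R + 1) 1; have := ler_normD x 1.
rewrite addrK normr1; lra.
Qed.

(** * Second differences, the discrete Laplacian and the explicit interpolant *)

Lemma second_difference_kernel (R : realType) (k i : nat) :
  (k.+2 - i.+1)%N%:R - 2 * (k.+1 - i.+1)%N%:R + (k - i.+1)%N%:R = (i == k)%:R :> R.
Proof.
have [ik|ki|->] := ltngtP i k.
- have -> : (k.+2 - i.+1 = (k - i.+1) + 2)%N by lia.
  have -> : (k.+1 - i.+1 = (k - i.+1) + 1)%N by lia.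
  by rewrite !natrD /=; ring.
- have -> : (k.+2 - i.+1 = 0)%N by lia.
  have -> : (k.+1 - i.+1 = 0)%N by lia.
  have -> : (k - i.+1 = 0)%N by lia.
  by rewrite /=; ring.
- have -> : (k.+2 - k.+1 = 1)%N by lia.
  have -> : (k.+1 - k.+1 = 0)%N by lia.
  have -> : (k - k.+1 = 0)%N by lia.
  by rewrite /=; ring.
Qed.

(** Writes [rho] as a linear term plus ramps, one per node, weighted by second differences. Since a
    ramp has second difference a Kronecker delta, both sides obey the same two-step recurrence and
    agree at [0] and [1]. *)
Lemma sum_second_difference (R : realType) (N : nat) (rho : nat -> R) (k : nat) :
  rho 0%N = 0 -> (k <= N)%N ->
  k%:R * rho 1%N
  - \sum_(i < N.-1) (2 * rho i.+1 - rho i - rho i.+2) * (k - i.+1)%N%:R = rho k.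
Proof.
move=> rho0; pose D (i : 'I_N.-1) := 2 * rho i.+1 - rho i - rho i.+2.
pose u (k : nat) := k%:R * rho 1%N - \sum_i D i * (k - i.+1)%N%:R.
rewrite -/(u k).
have rec (j : nat) : (j.+2 <= N)%N ->
    u j.+2 = 2 * u j.+1 - u j - (2 * rho j.+1 - rho j - rho j.+2).
  move=> jN; rewrite /u -(natr1 j.+1) -(natr1 j).
  have jl : (j < N.-1)%N by lia.
  have : \sum_i D i * (j.+2 - i.+1)%N%:R - 2 * (\sum_i D i * (j.+1 - i.+1)%N%:R)
      + \sum_i D i * (j - i.+1)%N%:R = D (Ordinal jl).
    rewrite mulr_sumr -sumrB -big_split /= (bigD1 (Ordinal jl))//= big1 ?addr0.
      transitivity (D (Ordinal jl) * (j == j)%:R); last by rewrite eqxx mulr1.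
      by rewrite -second_difference_kernel /=; ring.
    move=> i ij; transitivity (D i * (i == j :> nat)%:R).
      by rewrite -second_difference_kernel; ring.
    have -> : (i == j :> nat) = false by exact/negbTE.
    by rewrite mulr0.
  rewrite /D /=; lra.
suff H (j : nat) : ((j <= N)%N -> u j = rho j) /\ ((j.+1 <= N)%N -> u j.+1 = rho j.+1).
  by case: (H k).
elim: j => [|j [IH1 IH2]].
  split=> _; rewrite /u.
    by rewrite mul0r big1 ?subr0 ?rho0// => i _; rewrite sub0n mulr0.
  by rewrite mul1r big1 ?subr0// => i _; rewrite subSS sub0n mulr0.
split=> // jN; rewrite rec// IH1 ?IH2//; [lra|lia..].
Qed.

Lemma laplacian_coord (R : realType) (N : nat) (rho : nat -> R) (i : 'I_N.-1) :
  rho 0%N = 0 -> rho N = 0 ->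
  (laplacian R N *m \col_j rho j.+1) i 0
  = N%:R ^+ 2 * (2 * rho i.+1 - rho i - rho i.+2).
Proof.
move=> rho0 rhoN; have iN := ltn_ord i.
rewrite /laplacian -scalemxAl mxE; congr (_ * _); rewrite mxE.
have pick (k : nat) : \sum_(j < N.-1) (if (j == k :> nat) then rho j.+1 else 0)
    = if (k < N.-1)%N then rho k.+1 else 0.
  by rewrite -big_mkcond /= (big_ord1_eq _ (fun j => rho j.+1)).
(* Diagonal, left and right neighbours; those missing in the first and last rows are the boundary
   values [rho 0 = rho N = 0]. *)
transitivity (2 * (\sum_(j < N.-1) (if (j == i :> nat) then rho j.+1 else 0))
  - (\sum_(j < N.-1) (if (j.+1 == i :> nat) then rho j.+1 else 0))
  - \sum_(j < N.-1) (if (j == i.+1 :> nat) then rho j.+1 else 0)).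
  rewrite mulr_sumr -!sumrB; apply: eq_bigr => j _; rewrite !mxE -val_eqE /=.
  rewrite (eq_sym (i : nat) j) (eq_sym (i.+1) (j : nat)).
  by case: eqP => h1; case: eqP => h2; case: eqP => h3 /=; try lia; ring.
rewrite !pick iN; congr (_ - _ - _).
  case Ei : (i : nat) => [|k]; first by rewrite big1.
  under eq_bigr do rewrite eqSS.
  by rewrite pick ifT//; lia.
case: ifPn => // h; suff -> : i.+2 = N by rewrite rhoN.
lia.
Qed.

Lemma min_max_curvature_le (R : realType) (N : nat) (r : 'cV[R]_N.-1) :
  (2 <= N)%N -> (min_max_curvature r <= (3 * enorm (laplacian R N *m r))%:E)%E.
Proof.
move=> N2; have N0 : (0 : R) < N%:R by rewrite ltr0n; lia.
have N0' : (N%:R : R) != 0 by rewrite gt_eqF.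
(* Extension of [r] by zero to the boundary nodes: [insub] fails at node [N]. *)
pose rho k := if k is j.+1 then oapp (fun i => r i 0) 0 (insub j) else 0.
have rho0 : rho 0%N = 0 by [].
have rhoN : rho N = 0.
  have NE : N = N.-1.+1 by lia.
  by rewrite [X in rho X]NE /= insubF ?ltnn.
have rE : r = \col_j rho j.+1.
  by apply/colP => j; rewrite mxE /= valK.
set d := laplacian R N *m r.
have dE i : d i 0 = N%:R ^+ 2 * (2 * rho i.+1 - rho i - rho i.+2).
  by rewrite /d {1}rE laplacian_coord.
pose arg (i : 'I_N.-1) (y : R) := N%:R * y + - i.+1%:R.
(* The ramp expansion of [rho] with ramps replaced by rounded corners. The factor [N^-2] undoes the
   scaling of the Laplacian, and the chain rule cancels it in [w'']. *)
pose w (y : R) := N%:R * rho 1%N * y + - N%:R ^- 2 * \sum_i d i 0 * corner (arg i y).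
pose w' (y : R) := N%:R * rho 1%N * 1
  + - N%:R ^- 2 * \sum_i d i 0 * (N%:R * corner' (arg i y)).
pose w'' (y : R) := N%:R * rho 1%N * 0
  + - N%:R ^- 2 * \sum_i d i 0 * (N%:R * (N%:R * corner'' (arg i y))).
have Dw y : is_derive y (1 : R) w (w' y).
  apply: (is_derive_lin2 _ _ (is_derive_id y (1 : R))).
  by apply: is_derive_lin_sum => i; apply: is_derive_affine; exact: is_derive_corner.
have Dw' y : is_derive y (1 : R) w' (w'' y).
  apply: (is_derive_lin2 _ _ (is_derive_cst (1 : R) y (1 : R))).
  apply: is_derive_lin_sum => i.
  by apply: (is_deriveZ N%:R); apply: is_derive_affine; exact: is_derive_corner'.
have [dw w'E] := derivable01_is_derive (fun y _ => erefl (w y)) Dw.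
have [ddw w''E] := derivable01_is_derive w'E Dw'.
have w''_le y : `|w'' y| <= 3 * enorm d.
  rewrite /w'' mulr0 add0r.
  have -> : - N%:R ^- 2 * \sum_i d i 0 * (N%:R * (N%:R * corner'' (arg i y)))
      = - \sum_i d i 0 * corner'' (arg i y).
    rewrite mulNr mulr_sumr; congr (- _); apply: eq_bigr => i _.
    by field.
  rewrite normrN; apply: le_trans (ler_norm_sum _ _ _) _.
  have -> : 3 * enorm d = enorm d * (3 / 2 * 2) by field.
  (* Each [|d i 0|] is at most [|d|], and the hats sum up; the shift by [1] is there because corner
     [i] sits at node [i.+1]. *)
  apply: le_trans (ler_wpM2l (enorm_ge0 d) (ler_wpM2l _ (@sum_hat_le R N.-1 (N%:R * y - 1)))).
    rewrite !mulr_sumr; apply: ler_sum => i _.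
    rewrite normrM; apply: ler_pM => //; first exact: coord_le_enorm.
    apply: le_trans (corner''_le _) _.
    by rewrite /arg -(natr1 i) opprD addrA addrAC.
  lra.
have w_nat k : (k <= N)%N -> w (k%:R / N%:R) = rho k.
  move=> kN; rewrite -(sum_second_difference rho0 kN) /w.
  have -> : N%:R * rho 1%N * (k%:R / N%:R) = k%:R * rho 1%N by field.
  rewrite mulNr mulr_sumr; congr (_ - _); apply: eq_bigr => i _.
  have -> : arg i (k%:R / N%:R) = k%:R - i.+1%:R by rewrite /arg; field.
  by rewrite corner_nat dE; field.
apply: le_trans (_ : (ereal_sup
  [set `|derive01 (derive01 w) y|%:E | y in [set` `[0%R, 1%R]]] <= _)%E).
  apply: ereal_inf_lbound; exists w => //; split => //.
  - by have := w_nat 0%N (leq0n N); rewrite mul0r.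
  - by have := w_nat N (leqnn N); rewrite divff// rhoN.
  - by move=> i; rewrite w_nat 1?[in RHS]rE ?mxE//; have := ltn_ord i; lia.
apply: ge_ereal_sup => _ [y /= y01 <-].
by rewrite lee_fin -w''E.
Qed.

(** * Spectral bounds on the hessian, the coarse step and the final estimate *)

Lemma quad_form_sub_scalar (R : realType) (n : nat) (H : 'M[R]_n) (a : R) (v : 'cV[R]_n) :
  (v^T *m (H - a%:M) *m v) 0 0 = (v^T *m H *m v) 0 0 - a * enorm v ^+ 2.
Proof.
rewrite mulmxBr mulmxBl mul_mx_scalar -scalemxAl sqr_enorm.
by rewrite !mxE.
Qed.

Lemma loewner_ge_scalar (R : realType) (n : nat) (H : 'M[R]_n) (a : R) :
  loewner_le a%:M H ->
  H^T = H /\ forall v : 'cV_n, a * enorm v ^+ 2 <= (v^T *m H *m v) 0 0.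
Proof.
move=> [Hsym Hpos]; split.
  move: Hsym; rewrite linearB /= tr_scalar_mx => /(congr1 (fun A => A + a%:M)).
  by rewrite !subrK.
by move=> v; have := Hpos v; rewrite quad_form_sub_scalar subr_ge0.
Qed.

Lemma loewner_le_scalar (R : realType) (n : nat) (H : 'M[R]_n) (a : R) :
  loewner_le H a%:M -> forall v : 'cV_n, (v^T *m H *m v) 0 0 <= a * enorm v ^+ 2.
Proof.
move=> [_ Hpos] v; rewrite -subr_ge0; have := Hpos v.
have -> : a%:M - H = - (H - a%:M) by rewrite opprB.
by rewrite mulmxN mulNmx mxE quad_form_sub_scalar opprB.
Qed.

(** [P^+] is a left inverse of [P], and [4 <= N] makes the coarse space nonzero. *)
Lemma omega_xi_ge1 (R : realType) (N : nat) :
  ~~ odd N -> (4 <= N)%N -> 1 <= omega R N * xi R N.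
Proof.
move=> Neven N4.
have KU : restriction R N *m interpolation R N \in unitmx.
  (* Invertibility of [R P] is the Galerkin case [H = 1], [mu = 1]. *)
  have := @galerkin_unitmx R _ _ (interpolation R N) 1%:M 1 2^-1 ltr01.
  rewrite mulmx1; apply; first by rewrite invr_eq0 pnatr_eq0.
    by move=> v; rewrite mulmx1 mul1r sqr_enorm.
  by move=> z; exact: interpolation_inj.
have inv : interpolation_pinv R N *m interpolation R N = 1%:M.
  by rewrite /interpolation_pinv -mulmxA mulVmx.
apply: le_trans (opnorm_left_inverse _ inv) _; first lia.
rewrite mulrC ler_wpM2r ?opnorm_ge0//.
by rewrite /omega le_max lexx.
Qed.

Lemma enorm_coarse_step_le (R : realType) (N : nat) (f : 'cV[R]_N.-1 -> R)
    (mu L M : R) (x e : 'cV[R]_N.-1) (v : 'cV[R]_N./2.-1) :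
  ~~ odd N -> 0 < mu -> 0 < L -> 0 < M -> twice_differentiable f ->
  loewner_le mu%:M (hessian f (x + e)) -> loewner_le (hessian f (x + e)) L%:M ->
  (forall y z, opnorm (hessian f y - hessian f z) <= M * enorm (y - z)) ->
  (forall y, f x <= f y) ->
  enorm (x + e + coarse_step f (x + e) - x) <=
  Num.sqrt (L / mu) * enorm (e - interpolation R N *m v)
  + M / (2 * mu) * enorm e ^+ 2.
Proof.
move=> Neven mu0 L0 M0 [df dg] Hge Hle Hlip xmin.
have [Hsym Hcoer] := loewner_ge_scalar Hge.
have Hbound := loewner_le_scalar Hle.
have c0 : (2^-1 : R) != 0 by rewrite invr_eq0 pnatr_eq0.
have KU := galerkin_unitmx mu0 c0 Hcoer (fun z => @interpolation_inj R N z Neven).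
have res := newton_residual x e M0 dg Hlip.
rewrite (gradient_min df xmin) subr0 in res.
have best := galerkin_best e v mu0 L0 c0 Hsym Hcoer Hbound KU.
have corr := galerkin_enorm_le (hessian f (x + e) *m e - gradient f (x + e)) mu0 c0 Hcoer KU.
rewrite /coarse_step /restriction.
move: res best corr; set G := (_ *m invmx _ *m _).
move: G (hessian f (x + e)) (gradient f (x + e)) => G H g res best corr.
(* Projection error of [e] plus the image under [G] of the Newton residual. *)
have -> : x + e + - (G *m g) - x = (e - G *m (H *m e)) + G *m (H *m e - g).
  by rewrite mulmxBr addrA subrK addrAC (addrC x) addrK.
apply: le_trans (enormD _ _) _; apply: lerD => //.
apply: le_trans corr _; rewrite -enormN opprB ler_pdivrMr//.
suff -> : M / (2 * mu) * enorm e ^+ 2 * mu = M / 2 * enorm e ^+ 2 by [].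
by field; rewrite gt_eqF.
Qed.

Lemma powR_three_halves (R : realType) (x : R) : 0 <= x -> (x `^ (3 / 2)) ^+ 2 = x ^+ 3.
Proof.
move=> x0; rewrite -!powR_mulrn ?powR_ge0// -powRrM; congr (_ `^ _).
by field.
Qed.

(** With mesh [1 / N] the nodal error is at most [b = W / N^2], so the squared norm is at most
    [W^2 / (2 N^3)], and [1 / 2 <= 9 / 16 = (3 / 4)^2]. *)
Lemma interpolation_approx (R : realType) (N : nat) (r : 'cV[R]_N.-1)
    (w : R -> R) (W : R) :
  ~~ odd N -> (0 < N)%N -> interpolants r w -> 0 <= W ->
  (forall y, y \in `[0, 1] -> `|derive01 (derive01 w) y| <= W) ->
  enorm (r - interpolation R N *m \col_j w ((2 * j).+2%:R / N%:R)) <=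
  W * (3 / (4 * N%:R `^ (3 / 2))).
Proof.
move=> Neven Npos [dw ddw w0 w1 wr] W0 hW.
have N0 : (0 : R) < N%:R by rewrite ltr0n.
have p0 : 0 < N%:R `^ (3 / 2) :> R by rewrite powR_gt0.
have pE := powR_three_halves (ltW N0).
move: p0 pE; move: (N%:R `^ _) => p p0 pE.
pose rho (k : nat) := w (k%:R / N%:R).
have rE : r = \col_(i < N.-1) rho i.+1 by apply/colP => i; rewrite mxE /rho wr.
rewrite {1}rE.
have b0 : 0 <= N%:R ^- 2 * W by rewrite mulr_ge0// invr_ge0 sqr_ge0.
have := @enorm_interpolation_error R N rho (N%:R ^- 2 * W) Neven _ _ b0 _.
rewrite {1 2}/rho mul0r divff ?gt_eqF// => /(_ w0 w1) err.
have c0 : 0 <= 3 / (4 * p) by rewrite divr_ge0// mulr_ge0// ltW.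
rewrite -(@ler_pXn2r _ 2)// ?nnegrE ?enorm_ge0 ?(mulr_ge0 W0 c0)//.
apply: le_trans (err _) _.
  move=> i iN.
  have h0 : 0 < (N%:R : R)^-1 by rewrite invr_gt0.
  have y0 : 0 <= i%:R / N%:R :> R by rewrite divr_ge0.
  have e1 : rho i.+1 = w (i%:R / N%:R + N%:R^-1) by rewrite /rho -(natr1 i) mulrDl mul1r.
  have e2 : rho i.+2 = w (i%:R / N%:R + 2 * N%:R^-1).
    by rewrite /rho -addn2 natrD mulrDl.
  rewrite e1 e2 -exprVn; apply: second_difference_le => //.
  by rewrite -mulrDl ler_pdivrMr// mul1r -natrD addn2 ler_nat.
have -> : (W * (3 / (4 * p))) ^+ 2 = W ^+ 2 * (9 / 16) * (p ^+ 2)^-1.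
  by field; rewrite gt_eqF.
rewrite pE.
have -> : N%:R / 2 * (N%:R ^- 2 * W) ^+ 2 = W ^+ 2 * (1 / 2) * (N%:R ^+ 3)^-1.
  by field; rewrite gt_eqF.
apply: ler_wpM2r; first by rewrite invr_ge0 exprn_ge0// ltW.
by apply: ler_wpM2l; [exact: sqr_ge0|lra].
Qed.

(** Reduces a lower bound on the extended-real infimum to interpolants with a finite curvature
    bound; an infinite supremum is harmless. *)
Lemma le_min_max_curvature (R : realType) (N : nat) (r : 'cV[R]_N.-1) (x : R) :
  (forall w W, interpolants r w -> 0 <= W ->
     (forall y, y \in `[0, 1] -> `|derive01 (derive01 w) y| <= W) -> x <= W) ->
  (x%:E <= min_max_curvature r)%E.
Proof.
move=> H; apply: le_ereal_inf_tmp => _ [w rw <-].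
set S := (X in ereal_sup X).
have ub := @ereal_sup_ubound R S.
have in01 (y : R) : y \in `[0, 1] -> (`|derive01 (derive01 w) y|%:E <= ereal_sup S)%E.
  by move=> y01; apply: ub; exists y.
(* The value at [0] shows that the supremum is nonnegative, which excludes [-oo]. *)
have z01 : (0 : R) \in `[0, 1] by rewrite in_itv /= lexx ler01.
have := in01 _ z01.
move: in01; case: (ereal_sup S) => [s| |] in01; [|by move=> _; rewrite leey|by []].
rewrite !lee_fin => s0; apply: (H w) => //; first exact: le_trans (normr_ge0 _) s0.
Qed.

Unset Implicit Arguments.

Theorem corollary4p5 (R : realType) (N : nat) (N_even : ~~ odd N)
    (N_ge4 : (4 <= N)%N)
    (f : 'cV[R]_N.-1 -> R) (mu L M : R)
    (mu_gt0 : 0 < mu) (L_gt0 : 0 < L) (M_gt0 : 0 < M)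
    (f_diff2 : twice_differentiable f)
    (f_hess_ge : forall x, loewner_le mu%:M (hessian f x))
    (f_hess_le : forall x, loewner_le (hessian f x) L%:M)
    (f_hess_lip : forall x y,
       opnorm (hessian f x - hessian f y) <= M * enorm (x - y))
    (xstar : 'cV[R]_N.-1) (xstar_min : forall y, f xstar <= f y)
    (xk xk1 : 'cV[R]_N.-1) (xk1E : xk1 = xk + coarse_step f xk) :
  ((enorm (xk1 - xstar))%:E
     <= (Num.sqrt (L / mu))%:E * min_max_curvature (xk - xstar)
          * (3 / (4 * N%:R `^ (3 / 2)))%:E
        + (M * omega R N ^+ 2 * xi R N ^+ 2 / (2 * mu)
             * enorm (xk - xstar) ^+ 2)%:E)%E
  /\
  ((Num.sqrt (L / mu))%:E * min_max_curvature (xk - xstar)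
        * (3 / (4 * N%:R `^ (3 / 2)))%:E
      + (M * omega R N ^+ 2 * xi R N ^+ 2 / (2 * mu)
           * enorm (xk - xstar) ^+ 2)%:E
     <= (9 / (4 * N%:R `^ (3 / 2)) * Num.sqrt (L / mu)
           * enorm (laplacian R N *m (xk - xstar))
         + M * omega R N ^+ 2 * xi R N ^+ 2 / (2 * mu)
             * enorm (xk - xstar) ^+ 2)%:E)%E.
Proof.
set e := xk - xstar; set K := _ / (2 * mu) * _.
have e_xk : xk = xstar + e by rewrite /e addrC subrK.
have q0 : 0 < Num.sqrt (L / mu) by rewrite sqrtr_gt0 divr_gt0.
have N0 : (0 < N)%N by exact: leq_trans N_ge4.
have p0 : 0 < N%:R `^ (3 / 2) :> R by rewrite powR_gt0// ltr0n.
have coarse v : enorm (xk1 - xstar) <=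
    Num.sqrt (L / mu) * enorm (e - interpolation R N *m v) + K.
  have := enorm_coarse_step_le v N_even mu_gt0 L_gt0 M_gt0 f_diff2
    (f_hess_ge (xstar + e)) (f_hess_le (xstar + e)) f_hess_lip xstar_min.
  rewrite -e_xk -xk1E => /le_trans; apply.
  (* Here [M] is enlarged to [M omega^2 xi^2], as [omega xi >= 1]. *)
  rewrite lerD2l ler_wpM2r ?sqr_ge0// ler_wpM2r//.
    by rewrite invr_ge0 mulr_ge0// ltW.
  by rewrite -mulrA -exprMn ler_peMr ?(ltW M_gt0)// exprn_ege1// omega_xi_ge1.
move: q0 p0 coarse; move: (Num.sqrt _) (N%:R `^ _) (@interpolation_approx R N e)
  => q p approx q0 p0 coarse.
have c0 : 0 < 3 / (4 * p) by rewrite divr_gt0// mulr_gt0.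
have qc0 : 0 < q * (3 / (4 * p)) by exact: mulr_gt0.
(* The first inequality solved for the curvature, so that it can be checked on one interpolant at a
   time. *)
have low : (((enorm (xk1 - xstar) - K) / (q * (3 / (4 * p))))%:E <= min_max_curvature e)%E.
  apply: le_min_max_curvature => w W ew W0 hW.
  rewrite ler_pdivrMr// lerBlDr.
  apply: le_trans (coarse (\col_j w ((2 * j).+2%:R / N%:R))) _.
  rewrite lerD2r mulrCA ler_pM2l//.
  exact: approx.
have up : (min_max_curvature e <= (3 * enorm (laplacian R N *m e))%:E)%E.
  by apply: min_max_curvature_le; exact: leq_trans N_ge4.
(* Enclosed between two reals, the curvature is finite, and both claims become real inequalities. *)
move: low up; case: (min_max_curvature e) => [m| |] //.
rewrite -!EFinM -!EFinD !lee_fin => low up; split.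
  by move: low; rewrite ler_pdivrMr// lerBlDr mulrCA mulrA.
rewrite lerD2r.
have -> : 9 / (4 * p) * q * enorm (laplacian R N *m e) =
    q * (3 * enorm (laplacian R N *m e)) * (3 / (4 * p)).
  by field; rewrite gt_eqF.
by rewrite ler_pM2r// ler_pM2l.
Qed.
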